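(* Let $X$ be a Boolean space. (1) If $1\le d<\omega$ and $X$ has weight $<\aleph_d$, then $X$ is $d$-openly generated if and only if $X$ is AE(0). (2) $X$ is AE(0) if and only if $X$ is $\omega$-openly generated.
   Context: A Boolean space is a compact Hausdorff zero-dimensional space. A Boolean space $X$ is AE(0) (absolute extensor of dimension zero) if for every Boolean space $Y$, closed $Z\subseteq Y$ and continuous $f\colon Z\to X$ there is a continuous $g\colon Y\to X$ extending $f$. The weight of $X$ is the maximum of $\aleph_0$ and the least size of a base of $X$. For a Tychonoff space $X$, $C(X)$ is the set of continuous $f\colon X\to\mathbb{R}$. For a set $F$, $X/F$ is the quotient of $X$ obtained by identifying $x\sim y$ iff $f(x)=f(y)$ for all $f\in C(X)\cap F$, and $q^X_F\colon X\to X/F$ is the quotient map. For a set $S$, a family $\mathcal{C}\subseteq[S]^{<\aleph_1}$ of countable subsets of $S$ is a club if it is cofinal in $([S]^{<\aleph_1},\subseteq)$ and closed under unions of countable nonempty chains. For $d\le\omega$, a Tychonoff space $X$ is $d$-openly generated if there is a club $\mathcal{E}\subseteq[C(X)]^{<\aleph_1}$ such that $q^X_F$ is an open map for every $F$ that is the union of fewer than $d$ elements of $\mathcal{E}$. *)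

(* Defs.v *)
From HB Require Import structures.
From mathcomp Require Import all_boot all_order all_algebra.
From mathcomp Require Import all_classical all_reals all_analysis.

Set Implicit Arguments.
Unset Strict Implicit.
Unset Printing Implicit Defensive.

Import numFieldNormedType.Exports.

Local Open Scope classical_set_scope.
Local Open Scope card_scope.
Local Open Scope quotient_scope.

(* Cardinals are represented by sets up to equipotence [#=]. *)

Definition card_lt T U (A : set T) (B : set U) : Prop :=
  A #<= B /\ ~ (B #<= A).

Definition is_card_max T U V (A : set T) (B : set U) (W : set V) : Prop :=
  [/\ A #<= W, B #<= W & (W #<= A) \/ (W #<= B)].

Definition is_card_succ T U (A : set T) (B : set U) : Prop :=
  card_lt A B /\ forall (V : Type) (C : set V), card_lt A C -> B #<= C.

(* [is_aleph n A]: the set A has cardinality aleph_n. *)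
Fixpoint is_aleph (n : nat) (T : Type) (A : set T) : Prop :=
  match n with
  | 0 => A #= [set: nat]
  | m.+1 => exists (U : Type) (B : set U), is_aleph m B /\ is_card_succ B A
  end.

(* [is_weight X W]: the set W has cardinality the weight of X. *)
Definition is_weight (X : topologicalType) (T : Type) (W : set T) : Prop :=
  exists B : set (set X),
    [/\ basis B,
        forall B' : set (set X), basis B' -> B #<= B'
      & is_card_max [set: nat] B W].

Definition weight_lt_aleph (X : topologicalType) (d : nat) : Prop :=
  exists (T : Type) (W : set T) (U : Type) (A : set U),
    [/\ is_weight X W, is_aleph d A & card_lt W A].

(* The last clause is zero-dimensionality in the sense of a base of clopen
   sets; the library's [zero_dimensional] only asks that clopen sets separate
   points. *)
Definition boolean_space (X : topologicalType) : Prop :=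
  [/\ compact [set: X], hausdorff_space X & basis [set U : set X | clopen U]].

(* The partial map on Z is given by a total function of which only the values
   on Z matter. Hence the empty space is AE(0): when X is empty, f can only
   exist for an empty Y. Reading f as a map on Z alone would, for Z = set0,
   exclude the empty space (which is d-openly generated for every d); for
   nonempty X the two readings coincide. *)
Definition AE0 (X : topologicalType) : Prop :=
  forall (Y : topologicalType) (Z : set Y) (f : Y -> X),
    boolean_space Y -> closed Z -> {within Z, continuous f} ->
    exists2 g : Y -> X, continuous g & forall z, Z z -> g z = f z.

Definition Cfun (R : realType) (X : topologicalType) : set (X -> R) :=
  [set f | continuous f].
Arguments Cfun : clear implicits.

Section quotient_by_functions.
Context (R : realType) (X : topologicalType).
Implicit Types F : set (X -> R).

Definition agree_on F : rel X :=
  fun x y => `[< forall f, (Cfun R X `&` F) f -> f x = f y >].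

Lemma agree_on_refl F : reflexive (agree_on F).
Proof. by move=> x; apply/asboolP. Qed.

Lemma agree_on_sym F : symmetric (agree_on F).
Proof. by move=> x y; apply: asbool_equiv_eq; split=> h f /h. Qed.

Lemma agree_on_trans F : transitive (agree_on F).
Proof.
by move=> y x z /asboolP xy /asboolP yz; apply/asboolP => f Ff;
  rewrite (xy f Ff) (yz f Ff).
Qed.

Definition agree_equiv F : equiv_rel X :=
  EquivRel (agree_on F) (agree_on_refl F) (agree_on_sym F) (@agree_on_trans F).

(* X / F, with the quotient topology *)
Definition quot_space F : topologicalType :=
  quotient_topology {eq_quot (agree_equiv F)}.

Definition quot_map F : X -> quot_space F :=
  \pi_(quotient_topology {eq_quot (agree_equiv F)}).

End quotient_by_functions.

Definition is_open_map (X Y : topologicalType) (q : X -> Y) : Prop :=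
  forall U : set X, open U -> open (q @` U).

Definition countable_subsets T (S : set T) : set (set T) :=
  [set A | A `<=` S /\ countable A].

Definition club T (S : set T) (C : set (set T)) : Prop :=
  [/\ C `<=` countable_subsets S,
      forall A, countable_subsets S A -> exists2 B, C B & A `<=` B
    & forall K : set (set T), K `<=` C -> countable K -> K !=set0 ->
        total_on K subset -> C (\bigcup_(A in K) A)].

(* the ordinals d <= omega *)
Variant ordinal_le_omega := Fin of nat | Omega.

Definition lt_ordinal (n : nat) (d : ordinal_le_omega) : Prop :=
  match d with Fin m => (n < m)%N | Omega => True end.

(* unions of fewer than d elements of E, the union of no element included *)
Definition unions_lt T (d : ordinal_le_omega) (E : set (set T)) : set (set T) :=
  [set F | exists (n : nat) (G : set (set T)),
     [/\ lt_ordinal n d, G `<=` E, G #= `I_n & F = \bigcup_(A in G) A]].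

Definition openly_generated (R : realType) (d : ordinal_le_omega)
    (X : topologicalType) : Prop :=
  exists E : set (set (X -> R)),
    club (Cfun R X) E /\
    forall F, unions_lt d E F -> is_open_map (@quot_map R X F).

(* Main.v *)
Require Import Defs.
From mathcomp Require Import all_boot all_order all_algebra.
From mathcomp Require Import all_classical all_reals all_analysis.
From mathcomp Require Import wochoice.

(* Let X be a Boolean space. For a set T of clopen sets call two points T-equivalent when they
   lie in the same members of T. The T-quotient map is open iff the T-saturation of every
   clopen set is open; call T good in this case.

   If X is AE(0), then X is a retract of a Cantor cube whose coordinates are the clopen subsets
   of X. The preimage of a clopen c under the retraction g depends on finitely many coordinates
   only, its support. If T contains the support of each of its members, then T is good: given u
   in U that is T-equivalent to x, for y near x mix the coordinates of y in T with those of u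
   outside T, and apply g to obtain a point of U that is T-equivalent to y. This closure
   condition is preserved by arbitrary unions.

   Conversely, a club of countable sets with open quotient maps yields a closure operator,
   with countable closures of countable sets, such that unions of k < d countable closed sets
   are good. A stabilization argument removes the countability assumption. To extend
   f : Z -> X to Y, construct the extension modulo larger and larger T. A single clopen can
   always be added to a good T, hence so can countably many. To add the closure of an
   uncountable I to a union of k closed sets, enumerate I in a well-order all of whose initial
   segments are smaller than I and add the closures of the initial segments one after the
   other; each step adds the closure of a set of smaller cardinality to a union of k + 1 closed
   sets. Starting from k = 0 and #I < aleph_d, this reaches countable sets while k < d. *)

Set Implicit Arguments.
Unset Strict Implicit.
Unset Printing Implicit Defensive.

Import Order.TTheory GRing.Theory Num.Theory.
Import numFieldNormedType.Exports.

Local Open Scope classical_set_scope.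
Local Open Scope card_scope.
Local Open Scope ring_scope.

(** * Saturations in Boolean spaces *)

(** Near-covering compactness is applied to the filter of sequences containing a given one, as
    covering a point survives enlarging the sequence. Indices outside [D] are filtered out at the
    end. *)
Lemma compact_finite_subcover (X : topologicalType) (I : eqType) (K : set X)
    (D : set I) (f : I -> set X) :
  compact K -> (forall i, D i -> open (f i)) ->
  (forall x, K x -> exists2 i, D i & f i x) ->
  exists2 s : seq I, (forall i, i \in s -> D i) &
    forall x, K x -> exists2 i, i \in s & f i x.
Proof.
move=> /compact_near_coveringP cK of_ cov.
pose F := filter_from [set: seq I] (fun s => [set t : seq I | {subset s <= t}]).
have FF : Filter F.
  apply: filter_from_filter; first by exists [::].
  move=> s t _ _; exists (s ++ t) => // u stu.
  by split=> i si; apply: stu; rewrite mem_cat si ?orbT.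
have [] := cK _ F (fun t x => exists i, [/\ i \in t, D i & f i x]) FF.
  move=> x /cov[i Di fx].
  exists (f i, [set t : seq I | {subset [:: i] <= t}]); first split => /=.
  - by apply: open_nbhs_nbhs; split => //; exact: of_.
  - by exists [:: i].
  - by move=> [y t] [/= fy it]; exists i; split=> //; apply: it; rewrite inE.
move=> s _ /(_ s (fun _ => id)) sK.
exists [seq i <- s | `[<D i>]] => [i|x /sK[i [si Di fx]]].
  by rewrite mem_filter => /andP[/asboolP].
by exists i => //; rewrite mem_filter si andbT; apply/asboolP.
Qed.

Lemma boolean_clopen_nbhs (X : topologicalType) (x : X) (U : set X) :
  boolean_space X -> open U -> U x -> exists c, [/\ clopen c, c x & c `<=` U].
Proof.
move=> [_ _ [_ bX]] oU Ux.
have /(bX x) [c [cc cx] cU] : nbhs x U by apply: open_nbhs_nbhs; split.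
by exists c.
Qed.

Lemma clopen_setU_seq (X : topologicalType) (s : seq (set X)) :
  (forall c, c \in s -> clopen c) -> clopen (\bigcup_(c in [set` s]) c).
Proof.
elim: s => [|c s IHs] cs.
  rewrite (_ : \bigcup_(_ in _) _ = set0); first exact: clopen0.
  by rewrite -subset0 => x [].
rewrite (_ : \bigcup_(_ in _) _ = c `|` \bigcup_(d in [set` s]) d); last first.
  rewrite eqEsubset; split=> x.
    by move=> [d]; rewrite /= inE => /orP[/eqP->|ds dx]; [left|right; exists d].
  by move=> [cx|[d ds dx]]; [exists c|exists d]; rewrite //= inE ?eqxx// ds orbT.
apply: clopenU; first by apply: cs; rewrite inE eqxx.
by apply: IHs => d ds; apply: cs; rewrite inE ds orbT.
Qed.

Lemma boolean_separation (X : topologicalType) (A B : set X) :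
  boolean_space X -> closed A -> closed B -> A `&` B = set0 ->
  exists c, [/\ clopen c, A `<=` c & c `&` B = set0].
Proof.
move=> bX clA clB AB0.
have [cX _ _] := bX.
have [|||s sP sA] := @compact_finite_subcover X (set X) A
    [set c | clopen c /\ c `<=` ~` B] id.
- exact: subclosed_compact cX _.
- by move=> c [[]].
- move=> x Ax; have nBx : (~` B) x.
    by move=> Bx; suff : (A `&` B) x by rewrite AB0.
  have [c [cc cx cB]] := boolean_clopen_nbhs bX (closed_openC clB) nBx.
  by exists c.
exists (\bigcup_(c in [set` s]) c); split.
- by apply: clopen_setU_seq => c /sP[].
- by move=> x /sA[c sc cx]; exists c.
- by rewrite -subset0 => x [[c /sP[_ cB] cx] Bx]; exact: cB Bx.
Qed.

Section realizers.
Context (X : topologicalType).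
Implicit Types (T U : set (set X)) (c K : set X).

(* h : set X -> set Y restricted to the clopen members of T encodes a map from Y to the
   quotient of X by T; the realizers of y are the points of the fibre over the image of y. *)
Definition realizers (Y : Type) T (h : set X -> set Y) (y : Y) : set X :=
  [set x | forall c, T c -> clopen c -> (h c y <-> c x)].

(** With [h = id] the realizers of [x] form its [T]-equivalence class. *)
Definition saturation T K : set X := [set x | realizers T id x `&` K !=set0].

Definition open_saturations T := forall c, clopen c -> open (saturation T c).

Lemma realizers_sub (Y : Type) T T' (h : set X -> set Y) y :
  T `<=` T' -> realizers T' h y `<=` realizers T h y.
Proof. by move=> TT' x rx c /TT'; exact: rx. Qed.

(** The points of [K] that violate the condition of a given [c] form an open set. These sets cover
    the compact [K], so finitely many conditions exclude it. *)
Lemma realizers_finite (Y : Type) T (h : set X -> set Y) y K :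
  compact [set: X] -> closed K -> realizers T h y `&` K = set0 ->
  exists2 s : seq (set X), (forall c, c \in s -> T c /\ clopen c) &
    realizers [set` s] h y `&` K = set0.
Proof.
move=> cX clK TK0.
have cK : compact K by exact: subclosed_compact cX _.
have [||s sP sK] := @compact_finite_subcover X (set X) K [set c | T c /\ clopen c]
    (fun c => [set x | ~ (h c y <-> c x)]) cK.
- move=> c [_ [oc clc]]; have [hy|hy] := pselect (h c y).
    rewrite (_ : [set _ | _] = ~` c); first exact: closed_openC.
    by rewrite eqEsubset; split=> x /=; tauto.
  rewrite (_ : [set _ | _] = c)//.
  rewrite eqEsubset; split=> x /=; last by tauto.
  by move=> h1; apply: contrapT; tauto.
- move=> x Kx; apply: contrapT => h1.
  suff : (realizers T h y `&` K) x by rewrite TK0.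
  split=> // c Tc cc; apply: contrapT => h2; apply: h1; by exists c.
exists s => //; rewrite -subset0 => x [rx /sK[c sc]]; apply; apply: rx => //.
by case: (sP _ sc).
Qed.

(** Upper semicontinuity of the fibres: finitely many [c] show that the fibre misses [K], and they
    still do so wherever membership in the clopen sets [h c] is unchanged. *)
Lemma realizers_usc (Y : topologicalType) T (h : set X -> set Y) K :
  compact [set: X] -> closed K ->
  (forall c, T c -> clopen c -> clopen (h c)) ->
  open [set y | realizers T h y `&` K = set0].
Proof.
move=> cX clK hT; rewrite openE => y /= yK.
have [s sP sK] := realizers_finite cX clK yK.
have : nbhs y [set y' | forall c, c \in s -> (h c y' <-> h c y)].
  elim: s sP {sK} => [|c s IHs] sP; first by apply: nearW => y'.
  have {}IHs := IHs (fun d ds => sP d (mem_behead (s := c :: s) ds)).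
  have [oc clc] : clopen (h c) by have [] := sP c (mem_head _ _); exact: hT.
  have : nbhs y [set y' | h c y' <-> h c y].
    have [hy|hy] := pselect (h c y).
      by apply: filterS (open_nbhs_nbhs (conj oc hy)) => y' /=; tauto.
    have oC : open (~` h c) by exact: closed_openC.
    by apply: filterS (open_nbhs_nbhs (conj oC hy)) => y' /=; rewrite /setC/=; tauto.
  apply: filterS2 IHs => y' /= h1 h2 d; rewrite inE => /orP[/eqP->//|].
  exact: h1.
apply: filterS => y' hy' /=; rewrite -subset0 => x [rx Kx].
suff : (realizers [set` s] h y `&` K) x by rewrite sK.
split=> // c sc cc; rewrite -hy'//; apply: rx => //; by case: (sP _ sc).
Qed.

Lemma saturation_closed T K :
  compact [set: X] -> closed K -> closed (saturation T K).
Proof.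
move=> cX clK; rewrite -openC.
rewrite (_ : ~` _ = [set x | realizers T id x `&` K = set0]); last first.
  rewrite eqEsubset; split=> x /=; rewrite /saturation/=; last by move=> ->; case.
  by move/set0P/negP/negPn/eqP.
exact: realizers_usc.
Qed.

Lemma open_saturations_clopen T : open_saturations (T `&` clopen) = open_saturations T.
Proof.
rewrite /open_saturations; suff -> : saturation (T `&` clopen) = saturation T by [].
apply/funext => c; rewrite eqEsubset; split=> x [u [ru cu]]; exists u; split=> //.
  by move=> d Td cd; apply: ru.
by move=> d [Td _] cd; apply: ru.
Qed.

(** Adding [c] splits every class along [c], so the parts of [d] inside and outside [c] are
    saturated separately. *)
Lemma open_saturationsU1 T c : open_saturations T -> open_saturations (c |` T).
Proof.
have [cc|ncc] := pselect (clopen c); last first.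
  rewrite -[open_saturations (c |` T)]open_saturations_clopen.
  rewrite (_ : (c |` T) `&` clopen = T `&` clopen) ?open_saturations_clopen//.
  by rewrite eqEsubset; split=> d [] => [[->|]|]; split=> //; right.
move=> Tg d cd.
rewrite (_ : saturation _ _ = (saturation T (d `&` c) `&` c) `|`
   (saturation T (d `&` ~` c) `&` ~` c)).
  have ? : clopen (~` c) by exact: clopenC.
  apply: openU; apply: openI; try by apply: Tg; apply: clopenI.
    by case: cc.
  by case: (clopenC (set0 : set X) cc).
rewrite eqEsubset; split=> x.
  move=> [u [ru du]].
  have xu : c x <-> c u by apply: ru => //; left.
  have rT : realizers T id x u by move=> e Te; apply: ru; right.
  have [cx|cx] := pselect (c x); [left|right]; split=> //.
    by exists u; split=> //; split=> //; apply/xu.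
  by exists u; split=> //; split=> // /xu.
move=> [] [[u [ru [du cu]]] cx]; exists u; split=> // e [->|Te] ce /=; try by split.
- exact: ru.
- exact: ru.
Qed.

End realizers.
(** * Well-orders *)

Section well_order.
Context (Q : eqType) (R : rel Q).
Hypothesis woR : well_order R.

Lemma well_order_min (A : set Q) : A !=set0 -> exists2 m, A m & forall x, A x -> R m x.
Proof.
move=> [a Aa]; have [|m [[Am mA] _]] := woR (A := [pred x | `[<A x>]]).
  by exists a; apply/asboolP.
by exists m => [|x Ax]; [exact/asboolP|apply: mA; apply/asboolP].
Qed.

Lemma well_order_refl x : R x x.
Proof. by have [|m -> h] := @well_order_min [set x]; [exists x|exact: h]. Qed.

Lemma well_order_total x y : R x y \/ R y x.
Proof.
have [|m [->|->] h] := @well_order_min [set x; y]; first by exists x; left.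
  by left; apply: h; right.
by right; apply: h; left.
Qed.

(** Both points are minima of the pair, and minima are unique. *)
Lemma well_order_anti x y : R x y -> R y x -> x = y.
Proof.
move=> xy yx; have [|m [_ um]] := woR (A := [pred z | (z == x) || (z == y)]).
  by exists x; rewrite inE eqxx.
have um' z : z = x \/ z = y -> R z x -> R z y -> m = z.
  move=> zxy zx zy; apply: um; split; first by rewrite inE; case: zxy => ->; rewrite eqxx ?orbT.
  by move=> t; rewrite inE => /orP[] /eqP->.
have xx := well_order_refl x; have yy := well_order_refl y.
by rewrite -(um' x (or_introl erefl) xx xy); apply: um' => //; right.
Qed.

Lemma well_order_trans x y z : R x y -> R y z -> R x z.
Proof.
move=> xy yz; have [|m mA h] := @well_order_min [set t | [\/ t = x, t = y | t = z]].
  by exists x; constructor 1.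
have [mx my mz] : [/\ R m x, R m y & R m z].
  by split; apply: h; [constructor 1|constructor 2|constructor 3].
case: mA => E; subst m => //; first by rewrite (well_order_anti xy mx).
by rewrite -(well_order_anti yz my).
Qed.

Definition segment s := [set x | R x s /\ x <> s].

Definition down_closed (D : set Q) := forall x y, D y -> R x y -> D x.

Lemma segment_down_closed s : down_closed (segment s).
Proof.
move=> x y [ys yNs] xy; split; first exact: well_order_trans ys.
by move=> E; subst x; apply: yNs; exact: well_order_anti.
Qed.

Lemma segmentU1_down_closed s : down_closed (s |` segment s).
Proof.
move=> x y ys xy; have [->|xs] := eqVneq x s; [by left|right].
split; last exact/eqP.
by apply: well_order_trans xy _; case: ys => [->|[]//]; exact: well_order_refl.
Qed.

Lemma down_closed_segment D : down_closed D -> D <> setT ->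
  exists2 s, ~ D s & D = segment s.
Proof.
move=> dD DT; have [|s Ds smin] := @well_order_min (~` D).
  by apply/set0P/eqP => D0; apply: DT; rewrite -[D]setCK D0 setC0.
exists s => //; rewrite eqEsubset; split=> [x Dx|x [xs xNs]].
  have [xs|/(dD _ _ Dx)//] := well_order_total x s.
  by split=> // E; subst x.
apply: contrapT => /smin sx; apply: xNs; exact: well_order_anti.
Qed.

Lemma well_order_ind (P : Q -> Prop) :
  (forall s, (forall x, segment s x -> P x) -> P s) -> forall s, P s.
Proof.
move=> IH s; apply: contrapT => nP.
have [|m Pm mmin] := @well_order_min (~` P); first by exists s.
apply: Pm; apply: IH => x [xm xNm]; apply: contrapT => /mmin mx.
by apply: xNm; exact: well_order_anti.
Qed.

End well_order.

Lemma leq_well_order : well_order leq.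
Proof.
apply/antisymmetric_well_order; first exact: anti_leq.
move=> A [a Aa].
have ex : exists n, A n by exists a.
exists (ex_minn ex); case: ex_minnP => m Am h; split=> // x Ax; exact: h.
Qed.

(** * Extensions modulo a family of clopen sets *)

Section lifting.
Context (X Y : topologicalType) (Z : set Y) (f : Y -> X).
Hypothesis bX : boolean_space X.
Hypothesis bY : boolean_space Y.
Hypothesis clZ : closed Z.
Hypothesis cf : {within Z, continuous f}.
Implicit Types (T : set (set X)) (h : set X -> set Y).

(* h is a continuous map from Y to the quotient of X by T that extends the one induced by f
   on Z. *)
Definition partial_extension T h :=
  [/\ forall c, T c -> clopen c -> clopen (h c),
      forall c, T c -> clopen c -> forall z, Z z -> (h c z <-> c (f z))
    & forall y, realizers T h y !=set0].

Definition lifts T T' := forall h, partial_extension T h ->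
  exists2 h', partial_extension T' h' & forall c, T c -> h' c = h c.

Lemma lifts_trans T1 T2 T3 : T1 `<=` T2 -> lifts T1 T2 -> lifts T2 T3 -> lifts T1 T3.
Proof.
move=> T12 L12 L23 h /L12[h2 /L23[h3 p3 h32] h21]; exists h3 => // c T1c.
by rewrite h32 ?h21//; exact: T12.
Qed.

Lemma partial_extensionI T T' h : T' `&` clopen `<=` T -> partial_extension T h ->
  partial_extension T' h.
Proof.
move=> TT' [h1 h2 h3]; split=> [c Tc cc|c Tc cc|y].
- by apply: h1 => //; apply: TT'.
- by apply: h2 => //; apply: TT'.
- by have [x rx] := h3 y; exists x => c Tc cc; apply: rx => //; apply: TT'.
Qed.

(** Only the preimage of [c] has to be chosen. Goodness of [T] makes it a clopen condition on [y]
    whether the fibre over [y] meets [c] or its complement; where it meets both, a clopen set that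
    separates the two parts of [Z] decides. *)
Lemma liftsU1 T c : open_saturations T -> lifts T (c |` T).
Proof.
move=> Tg h [h1 h2 h3].
have [cc|ncc] := pselect (clopen c); last first.
  by exists h => //; apply: partial_extensionI (And3 h1 h2 h3) => d [[->|]].
have [Tc|nTc] := pselect (T c).
  by exists h => //; apply: partial_extensionI (And3 h1 h2 h3) => d [[->|]].
have [cX _ _] := bX.
(* Closedness is semicontinuity. For openness: a fibre is a full class, so it meets [d] iff it
   misses the complement of the saturation of [d], which is closed. *)
have hits_clopen d : clopen d -> clopen [set y | realizers T h y `&` d !=set0].
  move=> cd; split; last first.
    rewrite -openC (_ : ~` _ = [set y | realizers T h y `&` d = set0]).
      by apply: realizers_usc => //; case: cd.
    by rewrite eqEsubset; split=> y /=; [move/set0P/negP/negPn/eqP|move=> ->; case].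
  rewrite (_ : mkset _ = [set y | realizers T h y `&` ~` saturation T d = set0]).
    apply: realizers_usc => //; apply: open_closedC; exact: Tg.
  rewrite eqEsubset; split=> y /=.
    move=> [x [rx dx]]; rewrite -subset0 => x' [rx' nx']; apply: nx'; exists x.
    by split=> // e Te ce; rewrite -rx' ?rx.
  move=> E; have [x rx] := h3 y.
  have [u [ru du]] : saturation T d x.
    by apply: contrapT => nx; suff : (realizers T h y `&` ~` saturation T d) x by rewrite E.
  by exists u; split=> // e Te ce; rewrite -ru// rx.
pose A := [set y | realizers T h y `&` c !=set0].
pose B := [set y | realizers T h y `&` ~` c !=set0].
have cA : clopen A by exact: hits_clopen.
have cB : clopen B by apply: hits_clopen; exact: clopenC.
have fc d : clopen d -> closed (Z `&` f @^-1` d).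
  move=> [_ cld]; move/continuous_closedP: cf => /(_ _ cld).
  by move=> /closed_subspaceP[V clV VE]; rewrite setIC -VE; exact: closedI.
have [|D [cD fD Df]] := boolean_separation bY (fc _ cc) (fc _ (clopenC set0 cc)).
  by rewrite -subset0 => z [[_ cz] [_ ncz]]; exact: ncz cz.
have Zr z : Z z -> realizers T h z (f z) by move=> Zz d Td cd; exact: h2.
(* The choice is forced outside [A] and outside [B]; where both hold, [D] decides. *)
exists (fun d => if `[< d = c >] then (D `&` A) `|` ~` B else h d); last first.
  by move=> d Td; case: asboolP => // E; subst d.
split.
- move=> d Td cd; case: asboolP => [_|nE].
    by apply: clopenU; [exact: clopenI|exact: clopenC].
  by apply: h1 => //; case: Td.
- move=> d Td cd z Zz; case: asboolP => [->|nE]; last by apply: h2 => //; case: Td.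
  split=> [[[Dz _]|nBz]|cz].
  + apply: contrapT => ncz; suff : (D `&` (Z `&` f @^-1` ~` c)) z by rewrite Df.
    by [].
  + by apply: contrapT => ncz; apply: nBz; exists (f z); split=> //; exact: Zr.
  + left; split; first by apply: fD.
    by exists (f z); split=> //; exact: Zr.
- move=> y; set h' := fun _ => _.
  have hB : ~ B y -> A y.
    move=> nB; have [x rx] := h3 y; exists x; split=> //.
    by apply: contrapT => ncx; apply: nB; exists x.
  have [hy|nhy] := pselect ((D `&` A `|` ~` B) y).
    have [x [rx cx]] : A y by case: hy => [[]//|/hB].
    exists x => d Td cd; rewrite /h'; case: asboolP => [->|nE]; first by split.
    by apply: rx => //; case: Td.
  have [x [rx cx]] : B y by apply: contrapT => ?; apply: nhy; right.
  exists x => d Td cd; rewrite /h'; case: asboolP => [->|nE]; first by split.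
  by apply: rx => //; case: Td.
Qed.

Section transfinite.
Context (Q : eqType) (R : rel Q) (T : set Q -> set (set X)).
Hypothesis woR : well_order R.
Hypothesis mT : forall D D', D `<=` D' -> T D `<=` T D'.
Hypothesis cT : forall A : set (set Q), A !=set0 -> total_on A subset ->
  T (\bigcup_(D in A) D) `<=` \bigcup_(D in A) T D.
Hypothesis lT : forall s, lifts (T (segment R s)) (T (s |` segment R s)).

(** Zorn's lemma for pairs of a down-closed [D] and an extension modulo [T D]. The order is only a
    preorder, since values outside [T D] are arbitrary. A maximal [D] other than [setT] would be a
    segment, which [lT] enlarges. *)
Lemma lifts_transfinite : lifts (T set0) (T setT).
Proof.
move=> h0 ph0; have [cX _ _] := bX.
pose S := {p : set Q * (set X -> set Y) | [/\ down_closed R p.1,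
  partial_extension (T p.1) p.2 & forall c, T set0 c -> p.2 c = h0 c]}.
pose le (p q : S) := `[< (sval p).1 `<=` (sval q).1 /\
  forall c, T (sval p).1 c -> (sval q).2 c = (sval p).2 c >].
have S0 : [/\ down_closed R (set0 : set Q), partial_extension (T set0) h0
    & forall c, T set0 c -> h0 c = h0 c] by split.
have [||A totA|p maxp] := @ZL_preorder S (exist _ (set0, h0) S0) le.
- by move=> p; apply/asboolP; split.
- move=> q p r /asboolP[D1 h1] /asboolP[D2 h2]; apply/asboolP; split.
    exact: subset_trans D2.
  by move=> c Tc; rewrite h2 ?h1//; exact: mT Tc.
- have [A0|/set0P/negP/negPn/eqP A0] := pselect (A !=set0); last first.
    by exists (exist _ (set0, h0) S0) => s; rewrite A0.
  pose D := \bigcup_(p in A) (sval p).1.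
  have TD c : T D c -> exists2 p, A p & T (sval p).1 c.
    have -> : D = \bigcup_(E in [set (sval p).1 | p in A]) E by rewrite bigcup_image.
    move=> /cT[||_ [p Ap <-] Tc]; last by exists p.
      by have [p Ap] := A0; exists (sval p).1; exists p.
    move=> _ _ [p Ap <-] [q Aq <-].
    by have [/asboolP[]|/asboolP[]] := totA _ _ Ap Aq; [left|right].
  pose h c := [set y | exists2 p, A p & T (sval p).1 c /\ (sval p).2 c y].
  have hE p c : A p -> T (sval p).1 c -> h c = (sval p).2 c.
    move=> Ap Tc; rewrite eqEsubset; split=> y; last by move=> hy; exists p.
    move=> [q Aq [Tqc hy]].
    by have [/asboolP[_ h']|/asboolP[_ h']] := totA _ _ Ap Aq; move: hy; rewrite h'.
  have SD : [/\ down_closed R D, partial_extension (T D) h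
      & forall c, T set0 c -> h c = h0 c].
    split.
    + move=> x y [p Ap py] xy; exists p => //.
      by have [dp _ _] := svalP p; exact: dp xy.
    + split.
      * move=> c /TD[p Ap Tc]; rewrite (hE _ _ Ap Tc).
        by have [_ [h1 _ _] _] := svalP p; exact: h1.
      * move=> c /TD[p Ap Tc]; rewrite (hE _ _ Ap Tc).
        by have [_ [_ h2 _] _] := svalP p; exact: h2.
      (* By compactness an empty fibre of the union would be empty for finitely many [c], all of
         which belong to one stage of the chain. *)
      * move=> y; apply/set0P/eqP => r0.
        have [|s sT] := @realizers_finite X Y (T D) h y setT cX closedT.
          by rewrite setIT.
        suff [x rx] : realizers [set` s] h y !=set0.
          by rewrite setIT => r1; move: rx; rewrite r1.
        have [p Ap sp] : exists2 p, A p & forall c, c \in s -> T (sval p).1 c.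
          elim: s sT => [|c s IHs] sT; first by have [p Ap] := A0; exists p.
          have [p Ap hp] := IHs (fun d ds => sT d (mem_behead (s := c :: s) ds)).
          have [/TD[q Aq Tq] _] := sT c (mem_head _ _).
          have [/asboolP[pq _]|/asboolP[qp _]] := totA _ _ Ap Aq.
            exists q => // d; rewrite inE => /orP[/eqP->//|/hp]; exact: mT.
          exists p => // d; rewrite inE => /orP[/eqP->//|/hp//]; exact: mT Tq.
        have [_ [_ _ /(_ y)[x rx]] _] := svalP p; exists x => c sc cc.
        by rewrite (hE _ _ Ap (sp _ sc)); apply: rx => //; exact: sp.
    + have [p Ap] := A0; move=> c Tc.
      rewrite (hE p)//; last exact: mT Tc.
      by have [_ _ ->] := svalP p.
  exists (exist _ (D, h) SD) => p Ap; apply/asboolP; split=> /=.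
    by move=> x px; exists p.
  by move=> c Tc; exact: hE.
case: p maxp => -[D h] /= pD maxp; have [dD ph hh0] := pD; rewrite /= in dD ph hh0.
have [DT|DT] := pselect (D = setT); first by exists h => //; rewrite -DT.
have [s Ds DE] := down_closed_segment woR dD DT.
have [|h' ph' h'h] := lT (s := s) (h := h); first by rewrite -DE.
have sD : D `<=` s |` segment R s by rewrite -DE; right.
have pD' : [/\ down_closed R (s |` segment R s), partial_extension (T (s |` segment R s)) h'
    & forall c, T set0 c -> h' c = h0 c].
  split=> //; first exact: segmentU1_down_closed.
  by move=> c Tc; rewrite h'h ?hh0//; exact: mT Tc.
have /asboolP[D's _] : le (exist _ (_, h') pD') (exist _ (D, h) pD).
  apply: maxp; apply/asboolP; split=> //= c Tc; apply: h'h; by rewrite -DE.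
by case: Ds; apply: D's; left.
Qed.

End transfinite.

Lemma liftsI T T' : T' `&` clopen `<=` T -> lifts T T'.
Proof.
move=> TT' h ph; exists h => //; exact: partial_extensionI ph.
Qed.

(** The members of [N] are added one at a time along an injection into the naturals. Each stage adds
    finitely many sets to [T] and hence stays good. *)
Lemma lifts_countable T N : open_saturations T -> countable N -> lifts T (T `|` N).
Proof.
move=> Tg /countable_injP[e einj].
pose S (D : set nat) := T `|` [set c | N c /\ D (e c)].
have -> : T `|` N = S setT.
  by rewrite /S eqEsubset; split=> c [?|]; try (by left); [right|move=> []; right].
have {1}-> : T = S set0.
  by rewrite /S eqEsubset; split=> c; [by left|by case=> // -[]].
(* By injectivity of [e], stage [n] adds at most one set. *)
have SU1 n : S (n |` segment leq n) `<=` S (segment leq n) \/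
    exists2 c, e c = n & S (n |` segment leq n) = c |` S (segment leq n).
  have [[c [Nc ecn]]|nc] := pselect (exists c, N c /\ e c = n); [right|left].
    exists c => //; rewrite /S eqEsubset; split=> d.
      move=> [Td|[Nd [edn|?]]]; [by right; left| |by right; right].
      by left; apply: einj; rewrite ?inE// edn.
    by move=> [->|[Td|[Nd ?]]]; [right; split=> //; left|left|right; split=> //; right].
  move=> d [Td|[Nd [edn|?]]]; [by left| |by right].
  by exfalso; apply: nc; exists d.
have Sg n : open_saturations (S (segment leq n)).
  elim: n => [|n IHn].
    rewrite (_ : S _ = T)//; rewrite /S eqEsubset; split=> d; last by left.
    by move=> [//|[_ [/=]]]; rewrite leqn0 => /eqP.
  have -> : segment leq n.+1 = n |` segment leq n.
    rewrite eqEsubset; split=> m.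
      move=> [mn /eqP m_n]; have [->|m_n'] := eqVneq m n; [by left|right].
      by split; [rewrite -ltnS ltn_neqAle m_n|exact/eqP].
    by move=> [->|[mn _]]; split; rewrite /= ?leqnSn ?(leqW mn)//; apply/eqP;
      rewrite neq_ltn ltnS ?leqnn ?mn.
  have [Sn|[c _ ->]] := SU1 n; last exact: open_saturationsU1.
  rewrite (_ : S _ = S (segment leq n))//; rewrite eqEsubset; split=> // d.
  by move=> [?|[? ?]]; [left|right; split=> //; right].
apply: (lifts_transfinite leq_well_order).
- by move=> D D' DD' c [?|[? ?]]; [left|right; split=> //; exact: DD'].
- move=> A [D AD] _ c [Tc|[Nc [E AE Ec]]]; first by exists D => //; left.
  by exists E => //; right.
- move=> n; have [Sn|[c _ ->]] := SU1 n; last exact: liftsU1.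
  by apply: liftsI => c [/Sn].
Qed.

End lifting.
(** * Closure operators *)

Lemma card_le_injP T (U : pointedType) (A : set T) (B : set U) : A #<= B <->
  exists f : T -> U, (forall x, A x -> B (f x)) /\ {in A &, injective f}.
Proof.
split=> [/pcard_leP[f]|[f [fAB finj]]].
  by exists f; split=> [x Ax|]; [exact: funS|exact: inj].
by apply/pcard_leP/injfunPex; exists f.
Qed.

(** Hilbert's hotel: shift a copy of the naturals inside [D] and put [a] in the freed place. *)
Lemma infinite_setU1_card_le (T : pointedType) (a : T) (D : set T) :
  infinite_set D -> (a |` D) #<= D.
Proof.
move=> infD; have [Da|nDa] := pselect (D a).
  by apply: subset_card_le => x [->|].
have [e [eD einj]] := (card_le_injP _ _).1 ((infiniteP _).1 infD).
have {}einj : injective e by move=> m n; apply: einj; rewrite in_setT.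
have {}eD n : D (e n) by exact: eD.
pose g x := if pselect (exists n, e n = x) is left ex then e (sval (cid ex)).+1
  else if x == a then e 0%N else x.
apply/card_le_injP; exists g.
have gE n : g (e n) = e n.+1.
  rewrite /g; case: pselect => [ex|[]]; last by exists n.
  by case: cid => m /= /einj ->.
have ga : g a = e 0%N.
  by rewrite /g; case: pselect => [[n na]|_]; [case: nDa; rewrite -na|rewrite eqxx].
have gN x : x <> a -> (forall n, e n <> x) -> g x = x.
  move=> /eqP/negbTE xa nx; rewrite /g xa; case: pselect => // ex; exfalso.
  by have [n /nx] := ex.
have cases x : (a |` D) x -> [\/ x = a, exists n, x = e n | [/\ D x, x <> a & forall n, e n <> x]].
  move=> aDx; have [->|xa] := pselect (x = a); first by constructor 1.
  have [[n <-]|nx] := pselect (exists n, e n = x); first by constructor 2; exists n.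
  constructor 3; split=> //; first by case: aDx.
  by move=> n nE; apply: nx; exists n.
split=> [x /cases[->|[n ->]|[Dx xa xe]]|x y].
- by rewrite ga.
- by rewrite gE.
- by rewrite gN.
rewrite !inE => /cases[->|[n ->]|[Dx xa xe]] /cases[->|[m ->]|[Dy ya ye]];
  rewrite ?ga ?gE ?(gN x)// ?(gN y)//.
- by move=> /einj.
- by move=> /ye.
- by move=> /einj.
- by move=> /einj[->].
- by move=> /ye.
- by move=> /esym/xe.
- by move=> /esym/xe.
Qed.

Lemma countable_setU T (A B : set T) : countable A -> countable B -> countable (A `|` B).
Proof.
move=> cA cB; rewrite (_ : A `|` B = \bigcup_b if b then A else B).
  by apply: bigcup_countable => // -[].
rewrite eqEsubset; split=> x; first by case; [exists true|exists false].
by move=> [[] _]; [left|right].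
Qed.

Section closure.
Context (W : eqType) (h : seq W -> set W).
Implicit Types A T : set W.

(** The empty sequence is included, so the hull of the empty set may be nonempty. *)
Definition closed_under T := forall s, (forall c, c \in s -> T c) -> h s `<=` T.

Definition hull A := [set c | forall T, A `<=` T -> closed_under T -> T c].

Lemma hull_sub A : A `<=` hull A.
Proof. by move=> c Ac T AT _; exact: AT. Qed.

Lemma hull_min A T : A `<=` T -> closed_under T -> hull A `<=` T.
Proof. by move=> AT clT c /(_ T AT clT). Qed.

Lemma hull_closed A : closed_under (hull A).
Proof. by move=> s sA c sc T AT clT; apply: (clT s _ c sc) => d /sA; exact. Qed.

Lemma hull_mono A B : A `<=` B -> hull A `<=` hull B.
Proof.
by move=> AB; apply: hull_min; [apply: subset_trans AB _; exact: hull_sub|exact: hull_closed].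
Qed.

Lemma seq_total_on (F : set (set W)) (s : seq W) : F !=set0 -> total_on F subset ->
  (forall c, c \in s -> (\bigcup_(A in F) A) c) -> exists2 A, F A & forall c, c \in s -> A c.
Proof.
move=> [A0 FA0] totF; elim: s => [|c s IHs] sF; first by exists A0.
have [A FA sA] := IHs (fun d ds => sF d (mem_behead (s := c :: s) ds)).
have [B FB Bc] := sF c (mem_head _ _).
have [AB|BA] := totF _ _ FA FB; [exists B|exists A] => // d; rewrite inE => /orP[/eqP->//|].
- by move=> /sA /AB.
- exact: BA.
- exact: sA.
Qed.

Lemma closed_under_bigcup (F : set (set W)) : F !=set0 -> total_on F subset ->
  (forall A, F A -> closed_under A) -> closed_under (\bigcup_(A in F) A).
Proof.
move=> F0 totF Fcl s /(seq_total_on F0 totF)[A FA sA] c sc.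
by exists A => //; exact: Fcl sc.
Qed.

(** [h] is finitary: a finite sequence from the union of a chain lies in one member. *)
Lemma hull_bigcup (F : set (set W)) : F !=set0 -> total_on F subset ->
  hull (\bigcup_(A in F) A) `<=` \bigcup_(A in F) hull A.
Proof.
move=> F0 totF; rewrite -(bigcup_image F hull id); apply: hull_min.
  by move=> c [A FA Ac]; exists (hull A); [exists A|exact: hull_sub].
apply: closed_under_bigcup.
- by have [A FA] := F0; exists (hull A); exists A.
- move=> _ _ [A FA <-] [B FB <-].
  by have [AB|BA] := totF _ _ FA FB; [left|right]; exact: hull_mono.
- by move=> _ [A FA <-]; exact: hull_closed.
Qed.

Hypothesis counth : forall s, countable (h s).

Lemma countable_seq A : countable A -> countable [set s : seq W | forall c, c \in s -> A c].
Proof.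
move=> /countable_injP[e einj]; apply/countable_injP.
exists (pickle \o map e) => s t; rewrite !inE => sA tA /(pcan_inj pickleK).
elim: s t sA tA => [|c s IHs] [|d t]//= sA tA [ecd est].
congr cons; first by apply: einj ecd; rewrite inE; [apply: sA|apply: tA]; exact: mem_head.
by apply: IHs est => x xs; [apply: sA|apply: tA]; rewrite inE xs orbT.
Qed.

(** Countably many rounds of adding all [h s] reach a closed set, and each round stays countable. *)
Lemma hull_countable A : countable A -> countable (hull A).
Proof.
move=> cA.
pose step B := B `|` \bigcup_(s in [set s : seq W | forall c, c \in s -> B c]) h s.
pose u n := iter n step A.
have uS n m : (n <= m)%N -> u n `<=` u m.
  move=> /subnK <-; elim: (m - n)%N => [//|k IHk]; apply: subset_trans IHk _.
  by rewrite addSn /u iterS => c; left.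
have cu n : countable (u n).
  elim: n => [//|n IHn]; rewrite /u iterS; apply: countable_setU => //.
  by apply: bigcup_countable => //; exact: countable_seq.
apply: (@sub_countable _ _ _ (\bigcup_n u n)); last by apply: bigcup_countable.
apply: subset_card_le; apply: hull_min; first by move=> c Ac; exists 0%N.
move=> s; rewrite -(bigcup_image setT u id) => /seq_total_on[||_ [n _ <-] sn c hc].
- by exists (u 0%N); exists 0%N.
- by move=> _ _ [n _ <-] [m _ <-]; have [nm|/ltnW nm] := leqP n m; [left|right]; exact: uS.
- by exists (u n.+1); [exists n.+1|rewrite /u iterS; right; exists s].
Qed.

End closure.
(** * Unions of closed families *)

Section unions_of_closed.
Context (X : topologicalType) (h : seq (set X) -> set (set X)) (k : nat).
Hypothesis cX : compact [set: X].
Hypothesis counth : forall s, countable (h s).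
Implicit Types M t : nat -> set (set X).

Hypothesis countable_case : forall t,
  (forall i, (i < k)%N -> closed_under h (t i) /\ countable (t i)) ->
  open_saturations (\bigcup_(i in `I_k) t i).

(* If the saturation of c modulo M were not open, it would be smaller than the saturation
   modulo any family t of countable closed subsets of the M i, so that t could be enlarged to
   shrink the saturation. For the union of an infinite sequence of such steps the saturation
   is open, and compactness of its complement makes the sequence stabilize. *)
Lemma open_saturations_closed M : (forall i, (i < k)%N -> closed_under h (M i)) ->
  open_saturations (\bigcup_(i in `I_k) M i).
Proof.
move=> Mcl c cc; apply: contrapT => nopen.
have clc : closed c by case: cc.
pose P t := forall i, (i < k)%N ->
  [/\ closed_under h (t i), countable (t i) & t i `<=` M i].
have next t : P t -> exists t', P t' /\ (forall i, (i < k)%N -> t i `<=` t' i) /\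
    exists2 x, saturation (\bigcup_(i in `I_k) t i) c x &
      ~ saturation (\bigcup_(i in `I_k) t' i) c x.
  move=> Pt.
  have [x xt xM] : exists2 x, saturation (\bigcup_(i in `I_k) t i) c x &
      ~ saturation (\bigcup_(i in `I_k) M i) c x.
    apply: contrapT => nx; apply: nopen.
    rewrite (_ : saturation _ _ = saturation (\bigcup_(i in `I_k) t i) c).
      by apply: countable_case => // i ik; have [] := Pt i ik.
    rewrite eqEsubset; split=> x.
      move=> [u [ru cu]]; exists u; split=> //; apply: realizers_sub ru.
      by move=> d [i ik td]; exists i => //; have [_ _] := Pt i ik; exact.
    by move=> xt; apply: contrapT => xM; apply: nx; exists x.
  have xM0 : realizers (\bigcup_(i in `I_k) M i) id x `&` c = set0.
    by apply: contrapT => /eqP/set0P.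
  (* Finitely many members of the [M i] exclude [x]; adding them to the [t i] removes [x] from the
     saturation. *)
  have [s sM sc] := realizers_finite cX clc xM0.
  exists (fun i => hull h (t i `|` [set d | d \in s /\ M i d])); split; [|split].
  - move=> i ik; have [cl ct tM] := Pt i ik; split.
    + exact: hull_closed.
    + apply: hull_countable => //; apply: countable_setU => //.
      apply: (@sub_countable _ _ _ [set` s]); last first.
        by apply: finite_set_countable; exact: finite_seq.
      by apply: subset_card_le => d [].
    + by apply: hull_min; [move=> d [/tM|[]]|exact: Mcl].
  - by move=> i ik d td; apply: hull_sub; left.
  - exists x => // -[u [ru cu]].
    suff : (realizers [set` s] id x `&` c) u by rewrite sc.
    split=> // d ds cd; apply: ru => //.
    by have [[i ik Mi] _] := sM d ds; exists i => //; apply: hull_sub; right.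
have P0 : P (fun=> hull h set0).
  move=> i ik; split; [exact: hull_closed| |].
    by apply: hull_countable.
  by apply: hull_min => //; exact: Mcl.
pose St := {t | P t}.
pose nxt (t : St) : St :=
  exist _ (sval (cid (next _ (svalP t)))) (svalP (cid (next _ (svalP t)))).1.
pose u n := iter n nxt (exist _ _ P0).
have uS n m : (n <= m)%N -> forall i, (i < k)%N -> sval (u n) i `<=` sval (u m) i.
  move=> /subnK <-; elim: (m - n)%N => [|l IHl] i ik; first by rewrite add0n.
  apply: (subset_trans (IHl i ik)).
  rewrite addSn {2}/u iterS -/(u _).
  by have [_ [+ _]] := svalP (cid (next _ (svalP (u (l + n)%N)))); apply.
have uN n : exists2 x, saturation (\bigcup_(i in `I_k) sval (u n) i) c x &
    ~ saturation (\bigcup_(i in `I_k) sval (u n.+1) i) c x.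
  by have [_ [_]] := svalP (cid (next _ (svalP (u n)))).
pose t i := \bigcup_n sval (u n) i.
pose V n := ~` saturation (\bigcup_(i in `I_k) sval (u n) i) c.
(* By compactness, a point outside the limit saturation is already outside at a finite stage. *)
have Vt : forall x, ~ saturation (\bigcup_(i in `I_k) t i) c x -> exists n, V n x.
  move=> x xt.
  have x0 : realizers (\bigcup_(i in `I_k) t i) id x `&` c = set0.
    by apply: contrapT => /eqP/set0P.
  have [s st sc] := realizers_finite cX clc x0.
  have [n sn] : exists n, forall d, d \in s -> (\bigcup_(i in `I_k) sval (u n) i) d.
    elim: s st {sc} => [|d s IHs] st; first by exists 0%N.
    have [n sn] := IHs (fun e es => st e (mem_behead (s := d :: s) es)).
    have [[i ik [m _ dm]] _] := st d (mem_head _ _).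
    exists (maxn n m) => e; rewrite inE => /orP[/eqP->|/sn[j jk ej]].
      by exists i => //; exact: uS (leq_maxr _ _) _ ik _ dm.
    by exists j => //; exact: uS (leq_maxl _ _) _ jk _ ej.
  exists n => -[v [rv cv]]; suff : (realizers [set` s] id x `&` c) v by rewrite sc.
  by split=> // d ds cd; apply: rv => //; exact: sn.
have ot : open (saturation (\bigcup_(i in `I_k) t i) c).
  apply: countable_case => // i ik; split.
    rewrite /t -(bigcup_image setT (fun n => sval (u n) i) id).
    apply: closed_under_bigcup.
    - by exists (sval (u 0%N) i); exists 0%N.
    - move=> _ _ [n _ <-] [m _ <-].
      by have [nm|/ltnW nm] := leqP n m; [left|right]; exact: uS.
    - by move=> _ [n _ <-]; have [] := svalP (u n) i ik.
  by apply: bigcup_countable => // n _; have [] := svalP (u n) i ik.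
have [|n _|x /Vt[n Vx]|s _ sV] := @compact_finite_subcover X nat
   (~` saturation (\bigcup_(i in `I_k) t i) c) setT V.
- by apply: subclosed_compact cX _ => //; exact: open_closedC.
- by apply: closed_openC; exact: saturation_closed.
- by exists n.
(* From stage [n] on the saturation equals the limit, although step [n] still removes a point. *)
pose n := \max_(i <- s) i.
have [x xn xn1] := uN n.
have [|m ms] := sV x.
  move=> [v [rv cv]]; apply: xn1; exists v; split=> //.
  by apply: realizers_sub rv => d [i ik ud]; exists i => //; exists n.+1.
apply; have [v [rv cv]] := xn; exists v; split=> //; apply: realizers_sub rv.
move=> d [i ik ud]; exists i => //; apply: uS ud => //.
by rewrite /n; exact: leq_bigmax_seq.
Qed.

End unions_of_closed.

(** * Lifting to the hull of an uncountable family *)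

Section lifting_to_hull.
Context (X Y : topologicalType) (Z : set Y) (f : Y -> X).
Hypothesis bX : boolean_space X.
Hypothesis bY : boolean_space Y.
Hypothesis clZ : closed Z.
Hypothesis cf : {within Z, continuous f}.
Context (h : seq (set X) -> set (set X)).
Hypothesis counth : forall s, countable (h s).
Context (bound : nat -> set (set X) -> Prop).
Hypothesis bound_open : forall k I M, bound k I ->
  (forall i, (i < k)%N -> closed_under h (M i)) ->
  open_saturations (\bigcup_(i in `I_k) M i).
Hypothesis boundS : forall k I I', bound k I -> ~ countable I -> I' `<=` I ->
  ~ (I #<= I') -> bound k.+1 I'.

(** [bound k I] is the induction invariant: [I] is small enough to be added to a union of [k] closed
    sets. All [k], [I] and [M] are treated at once, because [k] grows while [I] shrinks. *)
Let liftable (J : set (set X)) := forall k I M, bound k I -> I #<= J ->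
  (forall i, (i < k)%N -> closed_under h (M i)) ->
  lifts Z f (\bigcup_(i in `I_k) M i) (\bigcup_(i in `I_k) M i `|` hull h I).

(* The set I is enumerated along an injection e into J. No segment of J is large enough for I,
   hence J has no largest element and the pieces Ie of I embed in proper segments of J. *)
Lemma liftable_step (R : rel (set X)) (J : set (set X)) : well_order R ->
  down_closed R J -> (forall s, J s -> liftable (segment R s)) -> liftable J.
Proof.
move=> woR dJ IH k I M bI IJ Mcl.
have openM := bound_open bI Mcl.
have [[s Js Is]|nIs] := pselect (exists2 s, J s & I #<= segment R s).
  exact: IH Js _ _ _ bI Is Mcl.
have [cI|ncI] := pselect (countable I).
  by apply: lifts_countable => //; exact: hull_countable.
have [e [eJ einj]] := (card_le_injP _ _).1 IJ.
pose Ie D := I `&` [set i | D (e i)].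
pose S D := \bigcup_(i in `I_k) M i `|` hull h (Ie D).
have IeS D D' : D `<=` D' -> Ie D `<=` Ie D' by move=> DD' c [? /DD'].
have SE : \bigcup_(i in `I_k) M i `|` hull h I = S setT.
  by rewrite /S (_ : Ie setT = I)// /Ie eqEsubset; split=> c; [case|].
(* The transfinite process starts at [S set0], which contains the countable hull of the empty
   set. *)
apply: (@lifts_trans _ _ _ _ _ (S set0)); first by left.
  apply: lifts_countable => //; apply: hull_countable => //.
  by rewrite (_ : Ie set0 = set0)// -subset0 => c [_ /=].
rewrite SE; apply: (lifts_transfinite bX woR).
- by move=> D D' DD' c [?|?]; [left|right; apply: hull_mono (IeS _ _ DD') _ _].
- move=> A [D AD] totA c [Mc|]; first by exists D => //; left.
  rewrite (_ : Ie _ = \bigcup_(B in [set Ie D | D in A]) B); last first.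
    rewrite bigcup_image eqEsubset; split=> d; first by move=> [Id [B AB Bd]]; exists B.
    by move=> [B AB [Id Bd]]; split=> //; exists B.
  move=> /hull_bigcup[||_ [B AB <-] Bc]; last by exists B => //; right.
    by exists (Ie D); exists D.
  move=> _ _ [B AB <-] [C AC <-].
  by have [BC|CB] := totA _ _ AB AC; [left|right]; exact: IeS.
move=> s.
(* As [e] takes [I] into [J], an index outside [J] adds nothing. *)
have [Js|nJs] := pselect (J s); last first.
  apply: liftsI => c [[Mc|hc] _]; [by left|right]; apply: hull_mono hc => d [Id].
  by move=> [/= eds|eds]; [case: nJs; rewrite -eds; exact: eJ|split].
(* Otherwise [s] is the largest element of [J]. As [J] is infinite, dropping [s] keeps its size, so
   [I] would embed in the segment of [s]. *)
have [s' Js' ss'] : exists2 s', J s' & s |` segment R s `<=` segment R s'.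
  apply: contrapT => ns'; apply: nIs; exists s => //.
  apply: (card_le_trans IJ).
  have Jle : J `<=` s |` segment R s.
    move=> x Jx; have [->|xs] := pselect (x = s); [by left|right; split=> //].
    have [//|sx] := well_order_total woR x s; exfalso; apply: ns'; exists x => //.
    move=> y [->|[ys yNs]]; first by split=> // E; apply: xs.
    split; first exact: well_order_trans sx.
    by move=> E; subst y; apply: xs; exact: (well_order_anti woR).
  apply: (card_le_trans (subset_card_le Jle)); apply: infinite_setU1_card_le => fs.
  apply: ncI; apply: (sub_countable IJ); apply: finite_set_countable.
  by apply: sub_finite_set Jle _; rewrite finite_setU; split=> //; exact: finite_set1.
have IeJ : Ie (s |` segment R s) #<= segment R s'.
  apply: (card_le_trans _ (subset_card_le ss')); apply/card_le_injP; exists e.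
  split=> [x []//|x y]; rewrite !inE => -[Ix _] [Iy _]; apply: einj; exact/mem_set.
have bS : bound k.+1 (Ie (s |` segment R s)).
  apply: (boundS bI ncI) => [c []//|II]; apply: nIs; exists s' => //.
  exact: card_le_trans II IeJ.
(* The hull built so far becomes one more closed set, with index [k]. *)
pose M' i := if (i < k)%N then M i else hull h (Ie (segment R s)).
have M'E : \bigcup_(i in `I_k.+1) M' i = S (segment R s).
  rewrite eqEsubset; split=> c.
    move=> [i /= ik]; rewrite /M'; case: ifPn => [ik'|_]; [by left; exists i|by right].
  move=> [[i ik Mc]|hc]; first by exists i; [exact: ltnW|rewrite /M' ik].
  by exists k => //=; rewrite /M' ltnn.
have M'cl i : (i < k.+1)%N -> closed_under h (M' i).
  by move=> _; rewrite /M'; case: ifP => [/Mcl//|_]; exact: hull_closed.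
have := IH s' Js' _ _ _ bS IeJ M'cl; rewrite M'E.
rewrite (_ : _ `|` _ = S (s |` segment R s))// eqEsubset; split=> c.
  move=> [[Mc|hc]|hc]; [by left| |by right].
  by right; apply: hull_mono hc; apply: IeS => d; right.
by move=> [Mc|hc]; [left; left|right].
Qed.

(** Well-ordered induction gives liftability for all proper segments, and one more step gives it for
    the whole type; then [k = 0] is taken. *)
Lemma lifts_hull I : bound 0 I -> lifts Z f set0 (hull h I).
Proof.
move=> bI; have [R woR] := well_ordering_principle (set X).
have lT : liftable setT.
  apply: (liftable_step woR) => // s _; move: s.
  apply: (well_order_ind woR) => s IHs.
  by apply: (liftable_step woR) => //; exact: segment_down_closed.
have := lT _ I (fun=> set0) bI (card_leT _).
rewrite (_ : \bigcup_(_ in _) _ = set0) ?set0U; last by rewrite -subset0 => c [].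
exact.
Qed.

End lifting_to_hull.

(** As [T] separates points, every fibre is a single point, and semicontinuity of the fibres is
    continuity of the resulting map. *)
Lemma AE0_of_lifts (X : topologicalType) (T : set (set X)) : boolean_space X ->
  (forall x y : X, x <> y -> exists c, [/\ T c, clopen c, c x & ~ c y]) ->
  (forall (Y : topologicalType) (Z : set Y) (f : Y -> X), boolean_space Y -> closed Z ->
     {within Z, continuous f} -> lifts Z f set0 T) -> AE0 X.
Proof.
move=> bX sepT LT Y Z f bY clZ cf.
have [cX _ _] := bX.
(* Modulo the empty family only nonemptiness of the fibres is required, and [f y] witnesses it. *)
have [|h [h1 h2 h3] _] := LT Y Z f bY clZ cf (fun=> set0).
  by split=> // y; exists (f y).
have rU y : exists x, realizers T h y x by have [x rx] := h3 y; exists x.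
pose g y := sval (cid (rU y)).
have gP y : realizers T h y (g y) by rewrite /g; case: cid.
have gE y x : realizers T h y x -> g y = x.
  move=> rx; apply: contrapT => /sepT[c [Tc cc gc ncx]]; apply: ncx.
  by apply/(rx _ Tc cc); apply/(gP y _ Tc cc).
exists g; last first.
  by move=> z Zz; apply: gE => c Tc cc; exact: h2.
apply/continuousP => A oA.
rewrite (_ : g @^-1` A = [set y | realizers T h y `&` ~` A = set0]).
  by apply: realizers_usc => //; exact: open_closedC.
rewrite eqEsubset; split=> y /=.
  by move=> Agy; rewrite -subset0 => x [/gE <-]; apply.
move=> E; apply: contrapT => nA.
by suff : (realizers T h y `&` ~` A) (g y) by rewrite E.
Qed.
(** * Clubs of countable sets of functions *)

Section clubs.
Context (T : Type) (S : set T).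

Lemma club_countable_subsets : club S (countable_subsets S).
Proof.
split=> [//|A cA|K KS cK _ _]; first by exists A.
split; first by move=> x [A /KS[AS _] Ax]; exact: AS.
by apply: bigcup_countable => // A /KS[].
Qed.

Lemma club_nat (E : set (set T)) (u : nat -> set T) : club S E ->
  (forall n, E (u n)) -> (forall n m, (n <= m)%N -> u n `<=` u m) -> E (\bigcup_n u n).
Proof.
move=> [_ _ Ech] Eu um; rewrite -(bigcup_image setT u id); apply: Ech.
- by move=> _ [n _ <-].
- by apply: card_le_trans (card_image_le _ _) _.
- by exists (u 0%N); exists 0%N.
- by move=> _ _ [n _ <-] [m _ <-]; have [nm|/ltnW nm] := leqP n m; [left|right]; exact: um.
Qed.

(** For cofinality, alternate countably often between adding all [D x] and enlarging to a member of
    [E]. *)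
Lemma club_closed_under (E : set (set T)) (D : T -> set T) : club S E ->
  (forall x, S x -> countable_subsets S (D x)) ->
  club S [set F | E F /\ forall x, F x -> D x `<=` F].
Proof.
move=> clubE cD; have [ES Ecof Ech] := clubE; split.
- by move=> F [/ES].
- move=> A cA.
  have next F : E F -> exists F', [/\ E F', F `<=` F' & forall x, F x -> D x `<=` F'].
    move=> EF; have [FS cF] := ES _ EF.
    have [|F' EF' sub] := Ecof (F `|` \bigcup_(x in F) D x).
      split; first by move=> x [/FS//|[y /FS/cD[+ _]]]; exact.
      by apply: countable_setU => //; apply: bigcup_countable => // x /FS/cD[].
    by exists F'; split=> // x; [move=> Fx|move=> Fx y Dy]; apply: sub; [left|right; exists x].
  have [F0 EF0 AF0] := Ecof A cA.
  pose nxt (F : {F | E F}) : {F | E F} :=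
    let w := cid (next _ (svalP F)) in exist _ (sval w) (and3_rec (fun a _ _ => a) (svalP w)).
  pose u n := iter n nxt (exist _ _ EF0).
  have uS n : sval (u n) `<=` sval (u n.+1).
    by have [] := svalP (cid (next _ (svalP (u n)))).
  have um n m : (n <= m)%N -> sval (u n) `<=` sval (u m).
    by move=> /subnK <-; elim: (m - n)%N => [|k IHk] //; apply: subset_trans IHk _; exact: uS.
  exists (\bigcup_n sval (u n)); last by move=> x /AF0; exists 0%N.
  split; first by apply: club_nat um => // n; exact: svalP (u n).
  move=> x [n _ ux] y Dy; exists n.+1 => //.
  by have [_ _ h] := svalP (cid (next _ (svalP (u n)))); exact: h Dy.
- move=> K KE cK K0 totK; split; first by apply: Ech => // F /KE[].
  by move=> x [F KF Fx] y Dy; exists F => //; have [_ h] := KE _ KF; exact: h Dy.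
Qed.

End clubs.

(** * Replacing sets of functions by sets of clopens *)

Section traces.
Context (R : realType) (X : topologicalType).
Hypothesis bX : boolean_space X.
Implicit Types (F : set (X -> R)) (c : set X) (f : X -> R).

Lemma indic_inj : injective (fun c : set X => \1_c : X -> R).
Proof.
move=> c d /funeqP cd; rewrite eqEsubset; split=> x; move: (cd x); rewrite !indicE.
  move=> + cx; rewrite mem_set//; case: (boolP (x \in d)) => [/set_mem//|_ /eqP].
  by rewrite oner_eq0.
move=> + dx; rewrite (mem_set dx); case: (boolP (x \in c)) => [/set_mem//|_ /esym/eqP].
by rewrite oner_eq0.
Qed.

Lemma indicP c x y : \1_c x = \1_c y :> R <-> (c x <-> c y).
Proof.
rewrite !indicE; split=> [E|cxy].
  split=> [cx|cy]; apply: contrapT => nc; move: E.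
    by rewrite (mem_set cx) (memNset nc) => /eqP; rewrite oner_eq0.
  by rewrite (mem_set cy) (memNset nc) => /esym/eqP; rewrite oner_eq0.
by congr (nat_of_bool _)%:R; apply/idP/idP => /set_mem ?; apply/mem_set/cxy.
Qed.

Lemma continuous_indic c : clopen c -> Cfun R X (\1_c).
Proof.
move=> cc; apply/continuousP => A _; rewrite preimage_indic.
by case: ifP => _; case: ifP => _; [exact: openT|case: cc|case: (clopenC c cc)|exact: open0].
Qed.

(** For rationals [p < q] a clopen set separates the points where [f] is at most [p] from those
    where it is at least [q]. Distinct values of [f] have two such rationals between them. *)
Lemma continuous_countable_clopens f : Cfun R X f -> exists V : set (set X),
  [/\ countable V, V `<=` clopen &
      forall x y, (forall c, V c -> (c x <-> c y)) -> f x = f y].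
Proof.
move=> cf.
have ex (pq : rat * rat) : exists c, clopen c /\ ((pq.1 < pq.2)%R ->
    f @^-1` [set t | (t <= ratr pq.1)%R] `<=` c /\
    c `&` f @^-1` [set t | (ratr pq.2 <= t)%R] = set0).
  have [lt|nlt] := pselect ((pq.1 < pq.2)%R); last by exists set0; split=> //; exact: clopen0.
  have cl A : closed A -> closed (f @^-1` A) by move: A; apply/continuous_closedP.
  have [|c [cc Ac cB]] := boolean_separation bX (cl _ (@closed_le R (ratr pq.1)))
      (cl _ (@closed_ge R (ratr pq.2))); last by exists c.
  rewrite -subset0 => x [/= h1 h2]; have := le_trans h2 h1.
  by rewrite ler_rat leNgt lt.
pose c pq := sval (cid (ex pq)).
have cP pq := svalP (cid (ex pq)).
exists (range c); split.
- by apply: card_le_trans (card_image_le _ _) _; exact: countableP.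
- by move=> _ [pq _ <-]; have [] := cP pq.
have nlt x y : (forall d, range c d -> (d x <-> d y)) -> ~ (f x < f y)%R.
  move=> xy lt.
  have [p] := rat_in_itvoo lt; rewrite in_itv /= => /andP[xp py].
  have [q] := rat_in_itvoo py; rewrite in_itv /= => /andP[pq qy].
  have [_] := cP (p, q); rewrite -/(c _) /= => -[|s1 s2].
    by move: pq; rewrite ltr_rat.
  have : c (p, q) x by apply: s1 => /=; exact: ltW.
  move/(xy _ (ex_intro2 _ _ _ I erefl)) => cy.
  suff : (c (p, q) `&` f @^-1` [set t | (ratr q <= t)%R]) y by rewrite s2.
  by split=> //=; exact: ltW.
move=> x y xy; have yx d : range c d -> (d y <-> d x) by move=> cd; have [] := xy d cd; split.
by case: (ltgtP (f x) (f y)) => // lt; [case: (nlt x y xy)|case: (nlt y x yx)].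
Qed.

Definition separating_clopens f : set (set X) :=
  if pselect (Cfun R X f) is left cf then sval (cid (continuous_countable_clopens cf))
  else set0.

Lemma separating_clopensP f : Cfun R X f -> [/\ countable (separating_clopens f),
  separating_clopens f `<=` clopen &
  forall x y, (forall c, separating_clopens f c -> (c x <-> c y)) -> f x = f y].
Proof. by rewrite /separating_clopens; case: pselect => // ? _; case: cid. Qed.

(** Under this condition [F] and its trace of clopen sets identify the same points. *)
Definition indic_closed F := forall f, F f ->
  [set \1_c | c in separating_clopens f] `<=` F.

Lemma indic_separating f : Cfun R X f ->
  countable_subsets (Cfun R X) [set \1_c | c in separating_clopens f].
Proof.
move=> /separating_clopensP[cV Vc _]; split.
  by move=> _ [c /Vc cc <-]; exact: continuous_indic.
exact: card_le_trans (card_image_le _ _) cV.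
Qed.

Definition trace F : set (set X) := [set c | clopen c /\ F (\1_c)].

Lemma trace_countable F : countable F -> countable (trace F).
Proof.
move=> cF; apply: card_le_trans cF.
apply: (@card_le_trans _ _ _ ((fun c : set X => \1_c : X -> R) @^-1` F)).
  by apply: subset_card_le => c [].
by apply: card_ge_preimage => c d _ _; exact: indic_inj.
Qed.

Lemma agree_on_trace F x y : F `<=` Cfun R X -> indic_closed F ->
  agree_on F x y <-> realizers (trace F) id x y.
Proof.
move=> FC iF; split=> [/asboolP xy c [cc Fc] _|rxy].
  by apply/indicP; apply: xy; split=> //; exact: continuous_indic.
apply/asboolP => f [cf Ff]; have [_ Vc] := separating_clopensP cf; apply=> c Vfc.
by apply: rxy; [split; [exact: Vc|apply: iF Ff _ _; exists c]|exact: Vc].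
Qed.

Lemma quot_mapP F x y : quot_map F x = quot_map F y <-> agree_on F x y.
Proof. by split=> [/eqmodP|xy]; last exact/eqmodP. Qed.

Lemma open_quot_map F : F `<=` Cfun R X -> indic_closed F ->
  is_open_map (quot_map F) <-> open_saturations (trace F).
Proof.
move=> FC iF.
have satE U : saturation (trace F) U = quot_map F @^-1` (quot_map F @` U).
  rewrite eqEsubset; split=> x.
    move=> [u [xu Uu]]; exists u => //; apply/quot_mapP; rewrite agree_on_sym.
    exact/agree_on_trace.
  move=> [u Uu ux]; exists u; split=> //; apply/agree_on_trace => //.
  by rewrite agree_on_sym; exact/quot_mapP.
split=> [oq c [oc _]|os U oU]; first by rewrite satE; exact: oq.
change (open (quot_map F @^-1` (quot_map F @` U))).
rewrite -satE openE => x [u [xu Uu]].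
have [c [cc cu cU]] := boolean_clopen_nbhs bX oU Uu.
have : nbhs x (saturation (trace F) c).
  by apply: open_nbhs_nbhs; split; [exact: os|exists u].
by apply: filterS => y [v [yv cv]]; exists v; split=> //; exact: cU.
Qed.

End traces.
(** * Retracts of Cantor cubes *)

Section cube.
Context (I : choiceType).

Definition cube : topologicalType := prod_topology (fun _ : I => bool).

Lemma cube_boolean : boolean_space cube.
Proof.
have cC : compact [set: cube].
  have := @tychonoff I (fun=> bool) (fun=> setT) (fun=> bool_compact).
  by congr compact; rewrite eqEsubset; split.
have hC : hausdorff_space cube.
  by apply: hausdorff_product => i; exact: discrete_hausdorff.
have zC : zero_dimensional cube.
  by apply: zero_dimension_prod => i; exact: discrete_zero_dimension.
split=> //; split=> [c []//|p].
have := zero_dimensional_cvg (x := p) hC zC cC.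
by move=> h A /h[c [cp cc] cA]; exists c.
Qed.

Lemma cube_coord_clopen i (b : bool) : clopen [set p : cube | p i = b].
Proof.
have : clopen (proj i @^-1` [set b] : set cube).
  apply: preimage_clopen; last exact: proj_continuous.
  by split; [exact: discrete_open|exact: discrete_closed].
by [].
Qed.

Lemma continuous_cube (Y : topologicalType) (e : Y -> cube) :
  (forall i, clopen [set y | e y i]) -> continuous e.
Proof.
move=> ce y; apply/cvg_sup => i A [V [[W oW <-] We] VA].
have cei : clopen [set y' | e y' i = e y i].
  case: (e y i); first exact: ce.
  rewrite (_ : mkset _ = ~` [set y' | e y' i]); first exact: (clopenC set0 (ce i)).
  by rewrite eqEsubset; split=> z /=; [move=> ez; rewrite /setC/= ez|move/negP/negbTE].
have : nbhs y [set y' | e y' i = e y i] by apply: open_nbhs_nbhs; split=> //; case: cei.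
by apply: filterS => z /= ez; apply: VA; rewrite /preimage/= /proj ez.
Qed.

(** By compactness of the complement, membership of a point [p] in [D] is secured by finitely many
    of its coordinates. Finitely many of the resulting neighbourhoods cover [D], and their
    coordinates are collected. *)
Lemma clopen_finite_support (D : set cube) : clopen D -> exists s : seq I,
  forall p q, (forall i, i \in s -> p i = q i) -> D p -> D q.
Proof.
move=> [oD clD]; have [cC _ _] := cube_boolean.
have s_ex (p : cube) : exists s : seq I, D p -> forall q : cube,
    (forall i, i \in s -> q i = p i) -> D q.
  have [Dp|nDp] := pselect (D p); last by exists [::].
  have [|i _|q nDq|s _ sD] := @compact_finite_subcover cube I (~` D) setT
      (fun i => [set q : cube | q i = ~~ p i]).
  - by apply: subclosed_compact cC _ => //; exact: open_closedC.
  - by case: (cube_coord_clopen i (~~ p i)).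
  - apply: contrapT => nq; apply: nDq; rewrite (_ : q = p)//; apply/funext => i.
    apply: contrapT => qp; apply: nq; exists i => //=.
    by move: qp; case: (q i); case: (p i).
  exists s => _ q qp; apply: contrapT => /sD[i /qp /= ->].
  by case: (p i).
pose s p := sval (cid (s_ex p)).
have sP p := svalP (cid (s_ex p)).
have [|p Dp|p Dp|ps psD psP] := @compact_finite_subcover cube cube D D
    (fun p => [set q : cube | forall i, i \in s p -> q i = p i]).
- exact: subclosed_compact cC _.
- elim: (s p) => [|i t IHt].
    by rewrite (_ : mkset _ = setT); [exact: openT|rewrite eqEsubset; split].
  rewrite (_ : mkset _ = [set q : cube | q i = p i] `&`
      [set q : cube | forall i, i \in t -> q i = p i]).
    by apply: openI => //; case: (cube_coord_clopen i (p i)).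
  rewrite eqEsubset; split=> q /=.
    by move=> qp; split=> [|j jt]; apply: qp; rewrite inE ?eqxx// jt orbT.
  by move=> [qi qt] j; rewrite inE => /orP[/eqP->//|/qt].
- by exists p.
exists (flatten (map s ps)) => p q pq Dp.
have [r rps rp] := psP p Dp; apply: (sP r (psD r rps)) => i ir.
rewrite -rp// -pq//; apply/flattenP; exists (s r) => //; exact: map_f.
Qed.

End cube.

Section retract_of_a_cube.
Context (X : topologicalType) (x0 : X).
Hypothesis bX : boolean_space X.
Hypothesis aX : AE0 X.

(** All subsets serve as indices; coordinates at non-clopen ones are constantly false. *)
Definition cube_embedding (x : X) : cube (set X) := fun c => `[< clopen c /\ c x >].

Lemma continuous_cube_embedding : continuous cube_embedding.
Proof.
apply: continuous_cube => c; have [cc|ncc] := pselect (clopen c).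
  rewrite (_ : mkset _ = c)// eqEsubset; split=> x; first by move=> /asboolP[].
  by move=> cx; apply/asboolP.
rewrite (_ : mkset _ = set0); first exact: clopen0.
by rewrite -subset0 => x /asboolP[].
Qed.

Lemma cube_embedding_inj : injective cube_embedding.
Proof.
have [_ hX _] := bX => x y xy; apply: contrapT => /eqP nxy.
move: hX; rewrite open_hausdorff => /(_ x y nxy)[[U V] /= [xU yV] [oU oV UV0]].
have [c [cc cx cU]] := boolean_clopen_nbhs bX oU (set_mem xU).
have : cube_embedding y c by rewrite -xy; apply/asboolP.
move=> /asboolP[_ /cU Uy]; have : (U `&` V) y by split=> //; exact: set_mem.
by rewrite (eqP UV0).
Qed.

(** The inverse of the embedding is continuous on its closed range, so AE(0) extends it to the cube.
    Off the range the given map takes the default value [x0]. *)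
Lemma cube_retraction : exists2 g : cube (set X) -> X, continuous g &
  forall x, g (cube_embedding x) = x.
Proof.
have [cX _ _] := bX; have [_ hC _] := cube_boolean (set X).
pose f (p : cube (set X)) := xget x0 [set x | cube_embedding x = p].
have fE x : f (cube_embedding x) = x.
  by apply: xget_unique => // y /cube_embedding_inj.
have [|||g cg gf] := aX (Y := cube (set X)) (Z := range cube_embedding) (f := f).
- exact: cube_boolean.
- apply: compact_closed => //; apply: continuous_compact => //.
  exact/continuous_subspaceT/continuous_cube_embedding.
- apply/subspace_continuousP => _ [x _ <-] A.
  change (nbhs (f (cube_embedding x)) A ->
    within (range cube_embedding) (nbhs (cube_embedding x)) (f @^-1` A)).
  rewrite fE nbhsE => -[V [oV Vx] VA].
  have [c [cc cx cV]] := boolean_clopen_nbhs bX oV Vx.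
  have : nbhs (cube_embedding x) [set q : cube (set X) | q c = true].
    apply: open_nbhs_nbhs; split; first by case: (cube_coord_clopen c true).
    exact/asboolP.
  apply: filterS => q qc [y _ yq]; rewrite -yq /= fE; apply: VA; apply: cV.
  by move: qc; rewrite -yq => /asboolP[].
by exists g => // x; rewrite gf ?fE//; exists x.
Qed.

Lemma AE0_supports : exists supp : set X -> seq (set X),
  forall T : set (set X), (forall c d, T c -> clopen c -> d \in supp c -> clopen d -> T d) ->
    open_saturations T.
Proof.
have [g cg ge] := cube_retraction.
have ex (c : set X) : exists s : seq (set X), clopen c -> forall p q : cube (set X),
    (forall i, i \in s -> p i = q i) -> c (g p) -> c (g q).
  have [cc|ncc] := pselect (clopen c); last by exists [::].
  have [s sP] := clopen_finite_support (preimage_clopen cc cg).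
  by exists s => _ p q; exact: sP.
exists (fun c => sval (cid (ex c))) => T Tsupp c cc; rewrite openE => x [u [ru cu]].
(* Coordinates in [T] come from [y], the others from [u]; thus [glue x] is the image of [u]. *)
pose glue y : cube (set X) := fun d => if `[< T d >] then cube_embedding y d
  else cube_embedding u d.
have glue_cont : continuous glue.
  apply: continuous_cube => d; rewrite /glue; case: asboolP => _.
    have [cd|ncd] := pselect (clopen d).
      rewrite (_ : mkset _ = d)// eqEsubset; split=> y; first by move=> /asboolP[].
      by move=> dy; apply/asboolP.
    rewrite (_ : mkset _ = set0); first exact: clopen0.
    by rewrite -subset0 => y /asboolP[].
  case: (cube_embedding u d).
    by rewrite (_ : mkset _ = setT); [exact: clopenT|rewrite eqEsubset; split].
  by rewrite (_ : mkset _ = set0); [exact: clopen0|rewrite eqEsubset; split].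
have glue_x : glue x = cube_embedding u.
  apply/funext => d; rewrite /glue; case: asboolP => // Td.
  apply: asbool_equiv_eq; split=> -[cd dx]; split=> //; exact/(ru d Td cd).
have : nbhs x ((g \o glue) @^-1` c).
  apply: open_nbhs_nbhs; split; last by rewrite /= glue_x ge.
  have gg : continuous (g \o glue).
    by move=> y; apply: continuous_comp; [exact: glue_cont|exact: cg].
  by move/continuousP: gg; apply; case: cc.
apply: filterS => y cy; exists (g (glue y)); split=> // d Td cd /=.
(* An index in the support of [d] but outside [T] is not clopen, so its coordinate is false for [u]
   and [y] alike. *)
have same i : i \in sval (cid (ex d)) -> glue y i = cube_embedding y i.
  move=> si; rewrite /glue; case: asboolP => // nTi.
  have nci : ~ clopen i by move=> ci; apply: nTi; exact: Tsupp si ci.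
  by apply: asbool_equiv_eq; split=> -[].
have sd := svalP (cid (ex d)) cd.
split=> h; last first.
  by rewrite -(ge y); apply: sd h.
by apply: (sd (cube_embedding y)); [move=> i /same|rewrite ge].
Qed.

End retract_of_a_cube.

Lemma AE0_openly_generated (R : realType) (X : topologicalType) :
  boolean_space X -> AE0 X -> openly_generated R Omega X.
Proof.
move=> bX aX; have [[x0 _]|X0] := pselect ([set: X] !=set0); last first.
  exists (countable_subsets (Cfun R X)); split; first exact: club_countable_subsets.
  move=> F _ U _; rewrite (_ : U = set0) ?image_set0; first exact: open0.
  by rewrite -subset0 => x; case: X0; exists x.
have [supp suppP] := AE0_supports x0 bX aX.
(* The first part allows passing to traces; the second closes the trace under supports. Both
   conditions concern one function at a time and therefore survive unions. *)
pose D (f : X -> R) : set (X -> R) := [set \1_c | c in separating_clopens bX f] `|`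
  [set \1_d | d in [set d | exists c, [/\ clopen c, f = \1_c, d \in supp c & clopen d]]].
have cD f : Cfun R X f -> countable_subsets (Cfun R X) (D f).
  move=> cf; have [V1 V2] := indic_separating bX cf; split.
    by move=> g [/V1//|[d [c [_ _ _ cd]] <-]]; exact: continuous_indic.
  apply: countable_setU => //; apply: card_le_trans (card_image_le _ _) _.
  have [[c [cc fc]]|nc] := pselect (exists c, clopen c /\ f = \1_c).
    apply: (@sub_countable _ _ _ [set` supp c]).
      by apply: subset_card_le => d [c' [_ fc' sd _]]; rewrite (indic_inj (etrans (esym fc) fc')).
    by apply: finite_set_countable; exact: finite_seq.
  apply: (@sub_countable _ _ _ (@set0 nat)) => //.
  rewrite (_ : mkset _ = set0)//.
  by rewrite -subset0 => d [c [cc fc _ _]]; apply: nc; exists c.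
have clubE := club_closed_under (club_countable_subsets (Cfun R X)) cD.
set E := mkset _ in clubE; exists E; split=> // F [n [G [_ GE _ ->]]].
have [ES _ _] := clubE.
have FC : \bigcup_(A in G) A `<=` Cfun R X.
  by move=> f [A /GE/ES[AsubC _] Af]; exact: AsubC.
have iF : indic_closed bX (\bigcup_(A in G) A).
  by move=> f [A GA Af] g Vg; exists A => //; have [_ h] := GE _ GA; apply: (h f Af); left.
apply/(open_quot_map FC iF); apply: suppP => c d [_ [A GA Ac]] cc dc cd; split=> //.
exists A => //; have [_ h] := GE _ GA; apply: (h _ Ac); right.
by exists d => //; exists c.
Qed.
(** * From open generation to AE(0) *)

Section closure_of_a_club.
Context (R : realType) (X : topologicalType) (E : set (set (X -> R))).
Hypothesis clubE : club (Cfun R X) E.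

(** Members of the club are indexed by finite sequences, so that a countable closed family can be
    exhausted by an increasing sequence of them. *)
Lemma club_seq : exists e : seq (set X) -> set (X -> R),
  (forall s, E (e s)) /\
  forall c s, e s `<=` e (c :: s) /\ (clopen c -> e (c :: s) (\1_c)).
Proof.
have [ES Ecof _] := clubE.
have next (c : set X) (F : {F | E F}) : exists F',
    [/\ E F', sval F `<=` F' & clopen c -> F' (\1_c)].
  have [FS cF] := ES _ (svalP F).
  have [|F' EF' sub] := Ecof (sval F `|` [set f | clopen c /\ f = \1_c]).
    split; first by move=> f [/FS//|[cc ->]]; exact: continuous_indic.
    apply: countable_setU => //; apply: (@sub_countable _ _ _ [set (\1_c : X -> R)]) => //.
    by apply: subset_card_le => f [].
  by exists F'; split=> // [f Ff|cc]; apply: sub; [left|right].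
have [F0 EF0 _] := Ecof set0 (conj (@sub0set _ _) (@countable0 _)).
pose nxt c F : {F | E F} :=
  let w := cid (next c F) in exist _ (sval w) (and3_rec (fun a _ _ => a) (svalP w)).
exists (fun s => sval (foldr nxt (exist _ _ EF0) s)); split=> [s|c s]; first exact: svalP.
by have [_ h1 h2] := svalP (cid (next c (foldr nxt (exist _ _ EF0) s))).
Qed.

(* The last clause makes the closure of a basis separate points, so that the weight bounds the
   number of generators without any cardinal arithmetic. *)
Lemma club_closure : exists h : seq (set X) -> set (set X), [/\
  forall s, countable (h s),
  forall T, countable T -> closed_under h T ->
    exists2 F, E F & trace F = T `&` clopen &
  forall U c V, clopen c -> U `<=` c -> c `<=` V ->
    exists2 d, h [:: U; V] d & [/\ clopen d, U `<=` d & d `<=` V]].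
Proof.
have [e [Ee eS]] := club_seq; have [ES _ _] := clubE.
pose between U V : set X := xget set0 [set c | [/\ clopen c, U `<=` c & c `<=` V]].
pose h s := trace (e s) `|` if s is [:: U; V] then [set between U V] else set0.
exists h; split=> [s|T cT Tcl|U c V cc Uc cV].
- apply: countable_setU; first by apply: trace_countable; have [] := ES _ (Ee s).
  by case: s => [|U [|V [|? ?]]].
- have /countable_injP[r rinj] := cT.
  have ex n (s : seq (set X)) : exists t : seq (set X), [/\ e s `<=` e t,
      (forall c, c \in s -> T c) -> forall c, c \in t -> T c
      & forall c, T c -> r c = n -> clopen c -> e t (\1_c)].
    have [[c [Tc rc]]|nc] := pselect (exists c, T c /\ r c = n); last first.
      by exists s; split=> // c Tc rc; case: nc; exists c.
    exists (c :: s); split=> [|sT d|d Td rd cd]; first by case: (eS c s).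
    + by rewrite inE => /orP[/eqP->//|/sT].
    + have -> : d = c by apply: rinj; rewrite ?inE// rd.
      by apply: (eS c s).2; rewrite (_ : c = d)//; apply: rinj; rewrite ?inE// rd.
  pose u := fix u n := if n is m.+1 then sval (cid (ex m (u m))) else [::].
  have uP m := svalP (cid (ex m (u m))).
  have uT n c : c \in u n -> T c.
    elim: n c => [//|n IHn] c; exact: (let: And3 _ b _ := uP n in b IHn c).
  exists (\bigcup_n e (u n)).
    apply: (club_nat clubE) => // n m /subnK <-.
    elim: (m - n)%N => [//|l IHl]; apply: subset_trans IHl _.
    by have [] := uP (l + n)%N.
  (* Closedness of [T] gives one inclusion; for the other, [c] enters at stage [r c + 1]. *)
  rewrite eqEsubset; split=> c.
    move=> [cc [n _ en]]; split=> //; apply: (Tcl (u n) (uT n)).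
    by left; split.
  move=> [Tc cc]; split=> //; exists (r c).+1 => //.
  by have [_ _ h3] := uP (r c); exact: h3.
- exists (between U V); first by right.
  by rewrite /between; case: xgetP => [d -> //|/(_ c)]; case.
Qed.

End closure_of_a_club.

(** The abstract [bound] lets the finite and the infinite case share one argument. It controls both
    the size of the family still to be added and the number of closed sets already in use. *)
Lemma openly_generated_AE0 (R : realType) (X : topologicalType) (d : ordinal_le_omega)
    (bound : nat -> set (set X) -> Prop) (B : set (set X)) :
  boolean_space X -> basis B -> bound 0%N B ->
  (forall k I, bound k I -> lt_ordinal k d) ->
  (forall k I I', bound k I -> ~ countable I -> I' `<=` I -> ~ (I #<= I') -> bound k.+1 I') ->
  openly_generated R d X -> AE0 X.
Proof.
move=> bX [oB bB] b0 bd bS [E0 [clubE0 openE0]].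
have clubE := club_closed_under clubE0 (indic_separating bX).
set E := mkset _ in clubE.
have [h [counth hE hsep]] := club_closure clubE.
have [ES _ _] := clubE.
have [cX hX _] := bX.
have bound_open k I (M : nat -> set (set X)) : bound k I ->
    (forall i, (i < k)%N -> closed_under h (M i)) ->
    open_saturations (\bigcup_(i in `I_k) M i).
  move=> bI; apply: (open_saturations_closed cX counth) => t tP.
  have F_ex i : exists F, (i < k)%N -> E F /\ trace F = t i `&` clopen.
    have [ik|_] := ltnP i k; last by exists set0.
    by have [tcl ct] := tP i ik; have [F EF Ft] := hE _ ct tcl; exists F.
  pose F i := sval (cid (F_ex i)).
  have FP i : (i < k)%N -> E (F i) /\ trace (F i) = t i `&` clopen by exact: svalP (cid (F_ex i)).
  have GE : \bigcup_(i in `I_k) F i = \bigcup_(A in F @` `I_k) A by rewrite bigcup_image.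
  rewrite -open_saturations_clopen.
  rewrite (_ : _ `&` _ = trace (\bigcup_(i in `I_k) F i)); last first.
    rewrite eqEsubset; split=> c.
      move=> [[i ik tc] cc]; split=> //; exists i => //.
      have [_ Et] := FP i ik.
      by have [] : trace (F i) c by rewrite Et.
    move=> [cc [i ik Fc]]; split=> //; exists i => //; have [_ Et] := FP i ik.
    by have [] : (t i `&` clopen) c by rewrite -Et.
  have FC : \bigcup_(i in `I_k) F i `<=` Cfun R X.
    by move=> f [i ik Ff]; have [/ES[FS _] _] := FP i ik; exact: FS.
  have iF : indic_closed bX (\bigcup_(i in `I_k) F i).
    by move=> f [i ik Ff] g Dg; exists i => //; have [[_ h1] _] := FP i ik; exact: h1 Dg.
  apply/(open_quot_map FC iF).
  apply: openE0; rewrite GE.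
  (* Some [F i] may coincide, so the union has [n] members with [n <= k]. *)
  have /finite_setP[n Gn] : finite_set (F @` `I_k) by exact: finite_image.
  exists n, (F @` `I_k); split=> //; last by move=> _ [i ik <-]; have [[]] := FP i ik.
  have : (n <= k)%N.
    rewrite -card_le_II; apply: card_le_trans (card_image_le F _).
    by move: Gn; rewrite card_eq_le => /andP[].
  by have := bd _ _ bI; case: (d) => //= m' /[swap]; exact: leq_ltn_trans.
apply: (AE0_of_lifts bX (T := hull h B)) => [x y xy|Y Z f bY clZ cf]; last first.
  exact: lifts_hull bX bY clZ cf h counth bound bound_open bS B b0.
have := hX; rewrite open_hausdorff => /(_ x y (introN eqP xy))[[U V] /= [xU yV] [oU oV UV0]].
(* The clopen [c] need not lie in the hull of [B], but the one that [hsep] inserts between the basic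
   sets [W] and [U'] does. *)
have [U' [BU' U'x] U'U] := bB x U (open_nbhs_nbhs (conj oU (set_mem xU))).
have [c [cc cx cU']] := boolean_clopen_nbhs bX (oB _ BU') U'x.
have [W [BW Wx] Wc] := bB x c (open_nbhs_nbhs (conj cc.1 cx)).
have [e he [ce We eU']] := hsep W c U' cc Wc cU'.
exists e; split=> //.
- apply: (hull_closed (s := [:: W; U']) _ he) => g; rewrite !inE => /orP[]/eqP->; exact: hull_sub.
- exact: We.
- move=> /eU'/U'U Uy; have : (U `&` V) y by split=> //; exact: set_mem.
  by rewrite (eqP UV0).
Qed.

(* #I < aleph_n with 0 < n and k + n <= d: after k splittings n more are enough. *)
Definition fin_bound T (d k : nat) (I : set T) :=
  exists (n : nat) (U : Type) (A : set U),
  [/\ (0 < n)%N, (k + n <= d)%N, is_aleph n A & ~ (A #<= I)].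

(** An uncountable [I] would be strictly larger than [B], so its successor [A] would embed in
    [I]. *)
Lemma not_card_le_aleph1 T U V (A : set T) (B : set U) (I : set V) : B #= [set: nat] ->
  is_card_succ B A -> ~ (A #<= I) -> countable I.
Proof.
move=> Bnat [_ succ] nAI; apply: contrapT => ncI; apply: nAI; apply: succ.
have [Bn nB] : B #<= [set: nat] /\ [set: nat] #<= B.
  by move: Bnat; rewrite card_eq_le => /andP[].
split=> [|IB]; last by apply: ncI; exact: card_le_trans IB Bn.
apply: (card_le_trans Bn); apply/infiniteP => fI; apply: ncI.
exact: finite_set_countable.
Qed.

(** Uncountability of [I] excludes [n = 1], so the predecessor [B] of [A] serves as the next bound.
    If [B] embedded in [I'], it would be strictly smaller than [I], and [A] would embed in [I]. *)
Lemma fin_boundS T (d k : nat) (I I' : set T) : fin_bound d k I ->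
  ~ countable I -> I' `<=` I -> ~ (I #<= I') -> fin_bound d k.+1 I'.
Proof.
move=> [n [U [A [n0 knd An nAI]]]] ncI I'I nII'.
case: n => [//|[|n]] in n0 knd An *; have [V [B [Bn sB]]] := An.
  by case: ncI; exact: not_card_le_aleph1 Bn sB nAI.
exists n.+1, V, B; split=> //; first by rewrite addSnnS.
move=> BI'; apply: nAI; have [_ succ] := sB; apply: succ.
split; first exact: card_le_trans BI' (subset_card_le I'I).
by move=> IB; apply: nII'; exact: card_le_trans IB BI'.
Qed.
Lemma openly_generated_fin (R : realType) (X : topologicalType) (d : nat) :
  openly_generated R Omega X -> openly_generated R (Fin d) X.
Proof.
move=> [E [clubE oE]]; exists E; split=> // F [n [G [_ GE Gn FG]]].
by apply: oE; exists n, G.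
Qed.

Theorem theorem2p16 (R : realType) (X : topologicalType)
  (hX : boolean_space X) :
  (forall d : nat, (1 <= d)%N -> weight_lt_aleph X d ->
     (openly_generated R (Fin d) X <-> AE0 X)) /\
  (AE0 X <-> openly_generated R Omega X).
Proof.
split=> [d d_gt0 [T [W [U [A [[B [bB _ [_ BW _]]] Ad [_ nAW]]]]]]|].
  split=> [|/(AE0_openly_generated R hX)]; last exact: openly_generated_fin.
  apply: (openly_generated_AE0 hX bB (bound := fin_bound d)).
  (* At [k = 0] the witness is [n = d]: the basis [B] is no larger than the weight. *)
  - by exists d, U, A; split=> // AB; apply: nAW; exact: card_le_trans AB BW.
  - by move=> k I [n [? [? [n_gt0 knd _ _]]]] /=; apply: leq_trans knd; rewrite -addn1 leq_add2l.
  - exact: fin_boundS.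
split; first exact: AE0_openly_generated.
have [_ _ bX] := hX.
(* Unions of any finite number of members are allowed, so no bound is imposed and all clopen sets
   serve as the basis. *)
exact: (openly_generated_AE0 hX bX (bound := fun _ _ => True)).
Qed.
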